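(* Let $\tau>0$ and let $$\mathcal{P}=\Big\{(\zeta,d)\in\mathbb{R}^2:\ \zeta>-1,\ \tfrac12 d^2+\zeta\big(\tfrac13\zeta^2-1\big)<\tfrac23\Big\}.$$ For any $(\zeta,d)\in\mathcal{P}$, the local solution $\theta$ of the initial value problem $$\theta''+\tau\theta'+\theta^2-1=0,\qquad \theta(0)=\zeta,\quad\theta'(0)=d,$$ is global and converges to $1$ at infinity, i.e. $\lim_{t\to\infty}\theta(t)=1$.
   Context: The independent variable is $t\ge0$ and primes denote $d/dt$. ''Global'' means that the maximal forward interval of existence of the solution is $[0,\infty)$. *)

(* Defs.v *)
From Stdlib Require Import Reals.
From Coquelicot Require Import Coquelicot.
Open Scope R_scope.

Definition calP (p : R * R) : Prop :=
  let (zeta, d) := p in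
  zeta > -1 /\ / 2 * d ^ 2 + zeta * (/ 3 * zeta ^ 2 - 1) < 2 / 3.

(* Derivative relative to the half-line [0, +oo): the usual derivative at
   t > 0, the right derivative at t = 0.  Values at negative times are never
   used. *)
Definition is_forward_derive (f : R -> R) (t l : R) : Prop :=
  filterdiff f (within (fun s => 0 <= s) (locally t)) (fun h => scal h l).

(* Only the values of theta on [0, T) matter. *)
Definition is_solution (tau zeta d : R) (T : Rbar) (theta : R -> R) : Prop :=
  Rbar_lt 0 T /\
  exists theta' theta'' : R -> R,
    (forall t : R, 0 <= t -> Rbar_lt t T ->
       is_forward_derive theta t (theta' t) /\
       is_forward_derive theta' t (theta'' t) /\
       theta'' t + tau * theta' t + theta t ^ 2 - 1 = 0) /\
    theta 0 = zeta /\ theta' 0 = d.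

Definition agree_upto (T : Rbar) (u v : R -> R) : Prop :=
  forall t : R, 0 <= t -> Rbar_lt t T -> u t = v t.

(* [0, T) is the maximal forward interval of existence of theta. *)
Definition is_maximal_solution (tau zeta d : R) (T : Rbar) (theta : R -> R)
    : Prop :=
  is_solution tau zeta d T theta /\
  forall (S : Rbar) (u : R -> R),
    is_solution tau zeta d S u -> agree_upto T u theta -> Rbar_le S T.

(* The well-posedness implicit in speaking of "the" local solution: some
   maximal solution restricts to every local solution. *)
Definition well_posed (tau zeta d : R) : Prop :=
  exists (T : Rbar) (theta : R -> R),
    is_maximal_solution tau zeta d T theta /\
    forall (S : Rbar) (u : R -> R),
      is_solution tau zeta d S u -> Rbar_le S T /\ agree_upto S u theta.

(* Main.v *)
(* Truncating the nonlinearity to [-1, 2] makes it globally Lipschitz, so Picard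
   iteration yields a global solution of the truncated problem.  Its energy
   [theta' ^ 2 / 2 + Phi (theta)] decreases and starts below 2/3, while the
   truncated potential [Phi] is at least 2/3 outside (-1, 2); hence the solution
   stays in (-1, 2) and solves the original equation.  The energy bound even keeps
   [theta] away from the unstable equilibrium -1, and adding a small cross term
   [(theta - 1) * theta'] to the energy gives a functional decaying exponentially. *)

Require Import Defs.
From Stdlib Require Import Reals Lra Psatz.
From Coquelicot Require Import Coquelicot.
Open Scope R_scope.

(** * Derivatives relative to the half-line *)

Lemma is_forward_derive_of_is_derive (f : R -> R) (t l : R) :
  0 <= t -> is_derive f t l -> is_forward_derive f t l.
Proof.
  intros Ht [Hlin Hdom].
  split; [exact Hlin|].
  intros x Hx.
  (* [filterdiff] quantifies over every limit [x] of the filter. The filter is proper because [t]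
     itself lies in the half-line, and this forces [x = t]. *)
  assert (Hpr : ProperFilter' (within (fun s : R => 0 <= s) (locally t))).
  { split; [|apply within_filter, locally_filter].
    intros [e He]. apply (He t); [apply ball_center|exact Ht]. }
  assert (Htx : t = x).
  { apply (is_filter_lim_unique (K := R_AbsRing) (V := R_NormedModule) (F := within (fun s : R => 0 <= s) (locally t)));
      [|exact Hx].
    exact (filter_le_within (F := locally t) (fun s : R => 0 <= s)). }
  subst x.
  refine (is_domin_le _ _ (Hdom t _) _).
  - intros P HP; exact HP.
  - apply filter_le_within.
Qed.

Lemma is_forward_derive_interior (f : R -> R) (t l : R) :
  0 < t -> is_forward_derive f t l -> is_derive f t l.
Proof.
  intros Ht [Hlin Hdom].
  split; [exact Hlin|].
  intros x Hx eps.
  assert (Hw : is_filter_lim (within (fun s : R => 0 <= s) (locally t)) x).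
  { intros P HP. apply filter_le_within. exact (Hx P HP). }
  generalize (Hdom x Hw eps). unfold within; intros Hd.
  assert (Hp : locally t (fun s : R => 0 <= s)).
  { generalize (open_gt 0 t Ht). apply filter_imp. intros s; lra. }
  generalize (filter_and _ _ Hd Hp). apply filter_imp.
  intros s [H1 H2]. exact (H1 H2).
Qed.

(** Freezing [f] at its value in 0 for negative times turns one-sided continuity at 0 into the
    two-sided continuity that the extreme and mean value theorems ask for. *)
Lemma is_forward_derive_continuity_pt (f : R -> R) (t l : R) :
  0 <= t -> is_forward_derive f t l ->
  continuity_pt (fun s => f (Rmax 0 s)) t.
Proof.
  intros Ht Hf.
  apply continuity_pt_filterlim.
  rewrite (Rmax_right 0 t Ht).
  apply (filterlim_comp _ _ _ (Rmax 0) f (locally t)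
           (within (fun s : R => 0 <= s) (locally t))).
  - intros P [e He]. exists e. intros s Hs. apply He.
    + change (Rabs (Rmax 0 s - t) < e). change (Rabs (s - t) < e) in Hs.
      revert Hs. unfold Rmax, Rabs. destruct Rle_dec; repeat destruct Rcase_abs; lra.
    + apply Rmax_l.
  - apply (filterdiff_continuous_aux (K := R_AbsRing) (U := R_NormedModule) (V := R_NormedModule)
             (F := within (fun s : R => 0 <= s) (locally t))).
    + exists (fun h => scal h l). exact Hf.
    + exact (filter_le_within (F := locally t) (fun s : R => 0 <= s)).
Qed.

Lemma is_derive_Rmax_0 (f : R -> R) (t l : R) :
  0 < t -> is_derive f t l -> is_derive (fun s => f (Rmax 0 s)) t l.
Proof.
  intros Ht Hf. apply (is_derive_ext_loc f); [|exact Hf].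
  generalize (open_gt 0 t Ht). apply filter_imp.
  intros s Hs. rewrite Rmax_right; [reflexivity|lra].
Qed.

(** * Gronwall's inequality and uniqueness *)

(** The inequality says that [W t * exp (- k * t)] has nonpositive derivative, so the mean value
    theorem applies. The sign of [k] is free: a positive rate serves uniqueness, 0 the decrease of
    the energy, a negative rate the exponential decay. *)
Lemma gronwall (W W' : R -> R) (k b : R) :
  0 <= b ->
  (forall t, 0 < t < b -> is_derive W t (W' t)) ->
  (forall t, 0 <= t <= b -> continuity_pt W t) ->
  (forall t, 0 <= t <= b -> W' t <= k * W t) ->
  W b <= W 0 * exp (k * b).
Proof.
  intros Hb Hd Hc Hle.
  destruct (MVT_gen (fun t => W t * exp (- k * t)) 0 b
              (fun t => (W' t - k * W t) * exp (- k * t))) as [c [Hcb Hm]].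
  - rewrite Rmin_left, Rmax_right by lra. intros t Ht.
    generalize (Hd t Ht); intros Hdt.
    auto_derive; [exists (W' t); exact Hdt|].
    replace (Derive (fun x => W x) t) with (W' t)
      by (symmetry; apply is_derive_unique; exact Hdt).
    ring.
  - rewrite Rmin_left, Rmax_right by lra. intros t Ht.
    apply continuity_pt_mult; [exact (Hc t Ht)|].
    apply derivable_continuous_pt. reg.
  - rewrite Rmin_left, Rmax_right in Hcb by lra.
    assert (He : exp (- k * b) * exp (k * b) = 1).
    { rewrite <- exp_plus. replace (- k * b + k * b) with 0 by ring. apply exp_0. }
    assert (Hneg : W b * exp (- k * b) <= W 0).
    { rewrite Rmult_0_r, exp_0, Rmult_1_r in Hm.
      generalize (Hle c Hcb) (exp_pos (- k * c)); intros Hl Hp.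
      assert ((W' c - k * W c) * exp (- k * c) * (b - 0) <= 0).
      { assert (0 <= (k * W c - W' c) * exp (- k * c) * b); [|nra].
        repeat apply Rmult_le_pos; lra. }
      lra. }
    apply Rmult_le_compat_r with (r := exp (k * b)) in Hneg;
      [|left; apply exp_pos].
    rewrite Rmult_assoc, He in Hneg. lra.
Qed.

(* The squared distance [W] of the two phase points satisfies [W' <= K W], with
   [K] governed by a bound of [u1 + u2] on the compact interval. *)
Lemma ivp_unique (tau b : R) (u1 p1 a1 u2 p2 a2 : R -> R) :
  0 <= b ->
  (forall t, 0 <= t <= b -> is_forward_derive u1 t (p1 t) /\
     is_forward_derive p1 t (a1 t) /\
     a1 t + tau * p1 t + u1 t ^ 2 - 1 = 0) ->
  (forall t, 0 <= t <= b -> is_forward_derive u2 t (p2 t) /\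
     is_forward_derive p2 t (a2 t) /\
     a2 t + tau * p2 t + u2 t ^ 2 - 1 = 0) ->
  u1 0 = u2 0 -> p1 0 = p2 0 -> u1 b = u2 b.
Proof.
  intros Hb H1 H2 Hu0 Hp0.
  set (ext := fun (f : R -> R) s => f (Rmax 0 s)).
  assert (Eext : forall f s, 0 <= s -> ext f s = f s).
  { intros f s Hs. unfold ext. rewrite Rmax_right by exact Hs. reflexivity. }
  assert (Cu1 : forall t, 0 <= t <= b -> continuity_pt (ext u1) t).
  { intros t Ht. destruct (H1 t Ht) as [H _].
    exact (is_forward_derive_continuity_pt _ _ _ (proj1 Ht) H). }
  assert (Cu2 : forall t, 0 <= t <= b -> continuity_pt (ext u2) t).
  { intros t Ht. destruct (H2 t Ht) as [H _].
    exact (is_forward_derive_continuity_pt _ _ _ (proj1 Ht) H). }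
  assert (Cp1 : forall t, 0 <= t <= b -> continuity_pt (ext p1) t).
  { intros t Ht. destruct (H1 t Ht) as [_ [H _]].
    exact (is_forward_derive_continuity_pt _ _ _ (proj1 Ht) H). }
  assert (Cp2 : forall t, 0 <= t <= b -> continuity_pt (ext p2) t).
  { intros t Ht. destruct (H2 t Ht) as [_ [H _]].
    exact (is_forward_derive_continuity_pt _ _ _ (proj1 Ht) H). }
  (* The square is only locally Lipschitz. As [u1 ^ 2 - u2 ^ 2 = (u1 + u2) * (u1 - u2)], the maximum
     of the sum on the compact interval acts as its Lipschitz constant. *)
  destruct (continuity_ab_maj (fun t => Rabs (ext u1 t + ext u2 t)) 0 b Hb)
    as [m [Hm _]].
  { intros t Ht. apply (continuity_pt_comp (fun t => ext u1 t + ext u2 t) Rabs);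
      [|apply Rcontinuity_abs].
    apply continuity_pt_plus; auto. }
  set (M := Rabs (ext u1 m + ext u2 m)) in Hm.
  set (e := fun t => ext u1 t - ext u2 t).
  set (q := fun t => ext p1 t - ext p2 t).
  (* The three summands of the rate bound [2 * e * q], the difference of the squares and the damping
     term, in this order. *)
  assert (HW : e b ^ 2 + q b ^ 2 <= (e 0 ^ 2 + q 0 ^ 2) * exp ((1 + M + 2 * Rabs tau) * b)).
  { apply (gronwall (fun t => e t ^ 2 + q t ^ 2)
      (fun t => 2 * e t * q t + 2 * q t * (ext a1 t - ext a2 t))); [exact Hb| | |].
    - intros t Ht.
      destruct (H1 t) as [D1 [D1' _]]; [lra|].
      destruct (H2 t) as [D2 [D2' _]]; [lra|].
      assert (De : is_derive e t (q t)).
      { unfold e, q. rewrite !Eext by lra.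
        apply (is_derive_minus (ext u1) (ext u2));
        (apply is_derive_Rmax_0; [lra|]; apply is_forward_derive_interior; [lra|assumption]). }
      assert (Dq : is_derive q t (ext a1 t - ext a2 t)).
      { unfold q. rewrite !Eext by lra.
        apply (is_derive_minus (ext p1) (ext p2));
        (apply is_derive_Rmax_0; [lra|]; apply is_forward_derive_interior; [lra|assumption]). }
      auto_derive; [repeat split; eexists; eassumption|].
      replace (Derive (fun x => e x) t) with (q t)
        by (symmetry; apply is_derive_unique; exact De).
      replace (Derive (fun x => q x) t) with (ext a1 t - ext a2 t)
        by (symmetry; apply is_derive_unique; exact Dq).
      ring.
    - intros t Ht.
      assert (Ce : continuity_pt e t) by (apply continuity_pt_minus; auto).
      assert (Cq : continuity_pt q t) by (apply continuity_pt_minus; auto).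
      apply continuity_pt_plus;
        apply (continuity_pt_comp _ (fun y => y ^ 2)); try assumption;
        apply derivable_continuous_pt; reg.
    - intros t Ht.
      destruct (H1 t Ht) as [_ [_ E1]].
      destruct (H2 t Ht) as [_ [_ E2]].
      assert (Ea : ext a1 t - ext a2 t =
                   - tau * q t - (ext u1 t + ext u2 t) * e t).
      { unfold e, q. rewrite !Eext by lra.
        replace (a1 t) with (- (tau * p1 t) - u1 t ^ 2 + 1) by lra.
        replace (a2 t) with (- (tau * p2 t) - u2 t ^ 2 + 1) by lra.
        ring. }
      rewrite Ea.
      generalize (Hm t Ht). fold M. set (s := ext u1 t + ext u2 t). intros Hs.
      assert (Hs' : - M <= s <= M).
      { revert Hs. unfold Rabs at 1. destruct Rcase_abs; lra. }
      assert (Ht' : - Rabs tau <= tau <= Rabs tau).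
      { unfold Rabs; destruct Rcase_abs; lra. }
      generalize (e t) (q t); intros x y.
      assert (- (2 * s * x * y) <= M * (x ^ 2 + y ^ 2)).
      { generalize (pow2_ge_0 (x + y)) (pow2_ge_0 (x - y)); intros.
        nra. }
      generalize (pow2_ge_0 (x - y)) (pow2_ge_0 x) (pow2_ge_0 y) (Rabs_pos tau); intros.
      nra. }
  assert (E0 : e 0 = 0) by (unfold e; rewrite !Eext by lra; lra).
  assert (Q0 : q 0 = 0) by (unfold q; rewrite !Eext by lra; lra).
  rewrite E0, Q0 in HW.
  assert (e b = 0) by (generalize (pow2_ge_0 (q b)); nra).
  unfold e in H. rewrite !Eext in H by exact Hb. lra.
Qed.

(** * Global existence for a Lipschitz force *)

(** Banach's fixed point argument in the norm with weight [exp (- K * t)]: the iterates of [u0] are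
    Cauchy at a geometric rate, and convergence in this norm is locally uniform, so the limit is
    continuous. *)
Lemma exp_weight_fixed_point (N : (R -> R) -> R -> R) (K C : R) (u0 : R -> R) :
  0 < K -> 0 <= C ->
  (forall u, (forall t, continuous u t) -> forall t, continuous (N u) t) ->
  (forall u w M, 0 <= M ->
     (forall t, continuous u t) -> (forall t, continuous w t) ->
     (forall t, 0 <= t -> Rabs (u t - w t) <= M * exp (K * t)) ->
     forall t, 0 <= t -> Rabs (N u t - N w t) <= M / 2 * exp (K * t)) ->
  (forall t, continuous u0 t) ->
  (forall t, 0 <= t -> Rabs (N u0 t - u0 t) <= C * exp (K * t)) ->
  exists u, (forall t, continuous u t) /\ (forall t, 0 <= t -> u t = N u t).
Proof.
  intros HK HC HN Hcon Hu0 HC0.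
  set (un := fix un n := match n with O => u0 | S n => N (un n) end).
  assert (Cn : forall n t, continuous (un n) t).
  { induction n; intros t; [apply Hu0|]. simpl. apply HN. exact IHn. }
  assert (Hhalf : forall n, 0 < (/ 2) ^ n) by (intros n; apply pow_lt; lra).
  assert (Hstep : forall n t, 0 <= t ->
            Rabs (un (S n) t - un n t) <= C * (/ 2) ^ n * exp (K * t)).
  { induction n; intros t Ht.
    - simpl. rewrite Rmult_1_r. apply HC0, Ht.
    - replace (C * (/ 2) ^ S n) with (C * (/ 2) ^ n / 2) by (simpl; field).
      apply (Hcon (un (S n)) (un n)); auto.
      apply Rmult_le_pos; [exact HC|left; apply Hhalf]. }
  (* Keeping the exact partial geometric sum, instead of its bound [(/ 2) ^ n], lets the induction
     on [m] close. *)
  assert (Hcau : forall n m t, 0 <= t ->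
            Rabs (un (n + m)%nat t - un n t) <= 2 * C * ((/ 2) ^ n - (/ 2) ^ (n + m)) * exp (K * t)).
  { intros n m t Ht. induction m.
    - rewrite Nat.add_0_r. rewrite Rminus_diag, Rabs_R0. lra.
    - rewrite Nat.add_succ_r.
      generalize (Hstep (n + m)%nat t Ht); intros H1.
      replace (un (S (n + m)) t - un n t) with
        ((un (S (n + m)) t - un (n + m)%nat t) + (un (n + m)%nat t - un n t)) by ring.
      eapply Rle_trans; [apply Rabs_triang|].
      replace ((/ 2) ^ S (n + m)) with ((/ 2) ^ (n + m) / 2) by (simpl; field).
      lra. }
  assert (Hcau' : forall n m t, 0 <= t ->
            Rabs (un (n + m)%nat t - un n t) <= 2 * C * (/ 2) ^ n * exp (K * t)).
  { intros n m t Ht. eapply Rle_trans; [apply Hcau, Ht|].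
    apply Rmult_le_compat_r; [left; apply exp_pos|].
    apply Rmult_le_compat_l; [lra|]. generalize (Hhalf (n + m)%nat); lra. }
  assert (Hsmall : forall A eps, 0 < eps -> exists n, A * (/ 2) ^ n < eps).
  { intros A eps He.
    assert (HA : 0 < Rabs A + 1) by (generalize (Rabs_pos A); lra).
    destruct (pow_lt_1_zero (/ 2)) with (y := eps / (Rabs A + 1)) as [n Hn].
    - rewrite Rabs_pos_eq; lra.
    - apply Rdiv_lt_0_compat; lra.
    - exists n. specialize (Hn n (le_n n)).
      rewrite Rabs_pos_eq in Hn by (left; apply Hhalf).
      apply Rmult_lt_compat_r with (r := Rabs A + 1) in Hn; [|exact HA].
      unfold Rdiv in Hn. rewrite Rmult_assoc, Rinv_l, Rmult_1_r in Hn by lra.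
      generalize (Rle_abs A) (Hhalf n); intros; nra. }
  assert (Hlim : forall t, 0 <= t -> ex_finite_lim_seq (fun n => un n t)).
  { intros t Ht. apply ex_lim_seq_cauchy_corr. intros eps.
    destruct (Hsmall (2 * C * exp (K * t)) (eps / 2)) as [n Hn]; [destruct eps; simpl; lra|].
    exists n. intros p m Hp Hm.
    replace p with (n + (p - n))%nat by lia.
    replace m with (n + (m - n))%nat by lia.
    generalize (Hcau' n (p - n)%nat t Ht) (Hcau' n (m - n)%nat t Ht).
    set (a := un (n + (p - n))%nat t). set (b := un (n + (m - n))%nat t). set (c := un n t).
    intros Ha Hb.
    replace (a - b) with ((a - c) - (b - c)) by ring.
    eapply Rle_lt_trans; [apply Rabs_triang|]. rewrite Rabs_Ropp. lra. }
  (* The iterates are controlled only for nonnegative times; [Rmax 0] makes the limit constant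
     before 0, hence continuous on the whole line. *)
  set (u := fun t => real (Lim_seq (fun n => un n (Rmax 0 t)))).
  assert (Hu : forall n t, 0 <= t ->
            Rabs (un n t - u t) <= 2 * C * (/ 2) ^ n * exp (K * t)).
  { intros n t Ht.
    assert (Hl : is_lim_seq (fun m => un m t) (u t)).
    { unfold u. rewrite Rmax_right by exact Ht. apply Lim_seq_correct', Hlim, Ht. }
    apply (is_lim_seq_incr_n _ n) in Hl.
    assert (Hl' : is_lim_seq (fun m => Rabs (un n t - un (m + n)%nat t)) (Rabs (un n t - u t))).
    { apply (is_lim_seq_abs _ (Finite (un n t - u t))).
      apply is_lim_seq_minus'; [apply is_lim_seq_const|exact Hl]. }
    apply (is_lim_seq_le _ (fun _ => 2 * C * (/ 2) ^ n * exp (K * t)) (Finite _) (Finite _))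
      with (2 := Hl'); [|apply is_lim_seq_const].
    intros m. rewrite Rabs_minus_sym, Nat.add_comm. apply Hcau', Ht. }
  assert (Cu : forall t, continuous u t).
  { intros t. apply filterlim_locally. intros eps.
    (* To the left of [t + 1] the weight is at most [exp (K * T)], so one [n] approximates [u]
       uniformly near [t] and an [eps / 3] argument applies. *)
    set (T := Rmax 0 (t + 1)).
    assert (HT : 0 <= T) by apply Rmax_l.
    destruct (Hsmall (2 * C * exp (K * T)) (eps / 3)) as [n Hn]; [destruct eps; simpl; lra|].
    assert (Hclose : forall s, s < t + 1 -> Rabs (un n (Rmax 0 s) - u s) < eps / 3).
    { intros s Hs.
      replace (u s) with (u (Rmax 0 s))
        by (unfold u; rewrite (Rmax_right 0 (Rmax 0 s)) by apply Rmax_l; reflexivity).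
      eapply Rle_lt_trans; [apply Hu, Rmax_l|].
      eapply Rle_lt_trans; [|exact Hn].
      rewrite (Rmult_assoc (2 * C)), (Rmult_comm ((/ 2) ^ n)), <- Rmult_assoc.
      apply Rmult_le_compat_r; [left; apply Hhalf|].
      apply Rmult_le_compat_l; [lra|].
      assert (Rmax 0 s <= T).
      { unfold T. apply Rle_max_compat_l. lra. }
      destruct (Rle_lt_or_eq_dec _ _ H) as [Hlt|Heq]; [|rewrite Heq; lra].
      left. apply exp_increasing. apply Rmult_lt_compat_l; assumption. }
    assert (Hc : locally t (fun s => Rabs (un n (Rmax 0 s) - un n (Rmax 0 t)) < eps / 3)).
    { assert (Hcont : continuous (fun s => un n (Rmax 0 s)) t).
      { apply (continuous_comp (Rmax 0) (un n)); [|apply Cn].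
        apply filterlim_locally. intros e. exists e. intros s Hs.
        change (Rabs (s - t) < e) in Hs. change (Rabs (Rmax 0 s - Rmax 0 t) < e).
        revert Hs. unfold Rmax, Rabs. repeat destruct Rle_dec; repeat destruct Rcase_abs; lra. }
      assert (He3 : 0 < eps / 3) by (destruct eps; simpl; lra).
      exact (proj1 (filterlim_locally _ _) Hcont (mkposreal _ He3)). }
    generalize (filter_and _ _ Hc (open_lt (t + 1) t ltac:(lra))).
    apply filter_imp. intros s [Hs Hst].
    change (Rabs (u s - u t) < eps).
    replace (u s - u t) with (- (un n (Rmax 0 s) - u s)
       + ((un n (Rmax 0 s) - un n (Rmax 0 t)) + (un n (Rmax 0 t) - u t))) by ring.
    eapply Rle_lt_trans; [apply Rabs_triang|]. rewrite Rabs_Ropp.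
    generalize (Rabs_triang (un n (Rmax 0 s) - un n (Rmax 0 t)) (un n (Rmax 0 t) - u t))
      (Hclose s Hst) (Hclose t ltac:(lra)).
    lra. }
  exists u. split; [exact Cu|].
  intros t Ht.
  apply Rminus_diag_uniq.
  destruct (Req_dec (u t - N u t) 0) as [H0|H0]; [exact H0|exfalso].
  apply Rabs_pos_lt in H0.
  destruct (Hsmall (2 * C * exp (K * t)) (Rabs (u t - N u t) / 2)) as [n Hn]; [lra|].
  generalize (Hcon (un n) u (2 * C * (/ 2) ^ n)
    ltac:(apply Rmult_le_pos; [lra|left; apply Hhalf]) (Cn n) Cu (Hu n) t Ht).
  generalize (Hu (S n) t Ht).
  replace (2 * C * (/ 2) ^ S n) with (2 * C * (/ 2) ^ n / 2) by (simpl; field).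
  simpl un. intros H1 H2.
  generalize (Rabs_triang (- (N (un n) t - u t)) (N (un n) t - N u t)).
  rewrite Rabs_Ropp.
  replace (- (N (un n) t - u t) + (N (un n) t - N u t)) with (u t - N u t) by ring.
  lra.
Qed.

(** Integrating the pointwise bound gives this value minus the nonnegative [M / K]. The gain [1 / K]
    is what makes the Picard map a contraction for large [K]. *)
Lemma RInt_exp_weight_le (g : R -> R) (M K t : R) :
  0 < K -> 0 <= t -> (forall s, continuous g s) ->
  (forall s, 0 <= s -> Rabs (g s) <= M * exp (K * s)) ->
  Rabs (RInt g 0 t) <= M / K * exp (K * t).
Proof.
  intros HK Ht Hg Hb.
  assert (HM : 0 <= M).
  { generalize (Hb 0 (Rle_refl 0)) (Rabs_pos (g 0)).
    rewrite Rmult_0_r, exp_0. lra. }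
  assert (HI : is_RInt (fun s => M * exp (K * s)) 0 t
                 (minus (M / K * exp (K * t)) (M / K * exp (K * 0)))).
  { apply (is_RInt_derive (fun s => M / K * exp (K * s))).
    - intros s _. auto_derive; [trivial|]. field. lra.
    - intros s _. apply (ex_derive_continuous (K := R_AbsRing) (V := R_NormedModule)).
      auto_derive; trivial. }
  assert (HR : is_RInt g 0 t (RInt g 0 t)).
  { apply (RInt_correct (V := R_CompleteNormedModule)), (ex_RInt_continuous (V := R_CompleteNormedModule)). intros; apply Hg. }
  assert (H : Rabs (RInt g 0 t) <= minus (M / K * exp (K * t)) (M / K * exp (K * 0))).
  { apply (norm_RInt_le (V := R_NormedModule) g (fun s => M * exp (K * s)) 0 t); auto.
    intros s Hs. apply Hb. lra. }
  change (minus (M / K * exp (K * t)) (M / K * exp (K * 0)))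
    with (M / K * exp (K * t) - M / K * exp (K * 0)) in H.
  rewrite Rmult_0_r, exp_0 in H.
  assert (0 <= M / K) by (apply Rdiv_le_0_compat; assumption).
  lra.
Qed.

Lemma is_derive_RInt_0 (g : R -> R) (t : R) :
  (forall s, continuous g s) -> is_derive (fun s => RInt g 0 s) t (g t).
Proof.
  intros Hg. apply (is_derive_RInt g (fun s => RInt g 0 s) 0); [|apply Hg].
  apply filter_forall. intros s. apply (RInt_correct (V := R_CompleteNormedModule)).
  apply (ex_RInt_continuous (V := R_CompleteNormedModule)). intros; apply Hg.
Qed.

Lemma lipschitz_continuous (F : R -> R) (L : R) :
  (forall x y, Rabs (F x - F y) <= L * Rabs (x - y)) ->
  forall x, continuous F x.
Proof.
  intros HF x. apply filterlim_locally. intros eps.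
  assert (HL : 0 < Rabs L + 1) by (generalize (Rabs_pos L); lra).
  assert (He : 0 < eps / (Rabs L + 1)) by (apply Rdiv_lt_0_compat; [apply eps|exact HL]).
  exists (mkposreal _ He). intros y Hy.
  change (Rabs (y - x) < eps / (Rabs L + 1)) in Hy. change (Rabs (F y - F x) < eps).
  apply Rmult_lt_compat_r with (r := Rabs L + 1) in Hy; [|exact HL].
  unfold Rdiv in Hy. rewrite Rmult_assoc, Rinv_l, Rmult_1_r in Hy by lra.
  generalize (HF y x) (Rle_abs L) (Rabs_pos (y - x)); intros; nra.
Qed.

(* Picard iteration for the velocity [v] alone: the position is recovered as
   [zeta + RInt v 0 t], and integration gains a factor [1 / K] in the norm
   weighted by [exp (- K t)]. *)
Lemma lipschitz_second_order_ivp (tau zeta d L : R) (F : R -> R) :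
  (forall x y, Rabs (F x - F y) <= L * Rabs (x - y)) ->
  exists x v : R -> R, x 0 = zeta /\ v 0 = d /\
    forall t, 0 <= t ->
      is_derive x t (v t) /\ is_derive v t (- tau * v t - F (x t)).
Proof.
  intros HF.
  assert (HL : 0 <= L).
  { generalize (HF 1 0) (Rabs_pos (F 1 - F 0)). rewrite Rminus_0_r, Rabs_R1. lra. }
  generalize (lipschitz_continuous F L HF); intros CF.
  set (pos := fun (v : R -> R) t => zeta + RInt v 0 t).
  set (acc := fun (v : R -> R) t => - tau * v t - F (pos v t)).
  set (N := fun (v : R -> R) t => d + RInt (acc v) 0 t).
  assert (Dpos : forall v, (forall t, continuous v t) -> forall t, is_derive (pos v) t (v t)).
  { intros v Hv t. unfold pos. rewrite <- (Rplus_0_l (v t)).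
    apply (is_derive_plus (fun _ => zeta) (fun t => RInt v 0 t));
      [apply (is_derive_const zeta)|apply is_derive_RInt_0, Hv]. }
  assert (Cacc : forall v, (forall t, continuous v t) -> forall t, continuous (acc v) t).
  { intros v Hv t. unfold acc.
    apply (continuous_minus (fun t => - tau * v t) (fun t => F (pos v t))).
    - apply (continuous_scal_r (- tau) v). apply Hv.
    - apply (continuous_comp (pos v) F); [|apply CF].
      apply (ex_derive_continuous (K := R_AbsRing) (V := R_NormedModule)).
      exists (v t). apply Dpos, Hv. }
  assert (DN : forall v, (forall t, continuous v t) -> forall t, is_derive (N v) t (acc v t)).
  { intros v Hv t. unfold N. rewrite <- (Rplus_0_l (acc v t)).
    apply (is_derive_plus (fun _ => d) (fun t => RInt (acc v) 0 t));
      [apply (is_derive_const d)|apply is_derive_RInt_0, Cacc, Hv]. }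
  (* [acc] changes by at most [Rabs tau + L] times the weighted distance, so dividing by [K] leaves
     a factor at most 1/2. The added 1 gives [1 <= K], so passing from velocity to position does not
     enlarge that distance. *)
  set (K := 2 * (Rabs tau + L) + 1).
  assert (HK : 1 <= K) by (unfold K; generalize (Rabs_pos tau); lra).
  assert (Hexp : forall t, 0 <= t -> 1 <= exp (K * t) /\ t <= exp (K * t)).
  { intros t Ht. generalize (exp_ineq1_le (K * t)). nra. }
  (* The constant comes from the starting velocity [d]: its [acc] at time [s] is at most [Rabs tau *
     Rabs d + Rabs (F zeta) + L * s * Rabs d], and both 1 and [s] are below [exp (K * s)]. *)
  destruct (exp_weight_fixed_point N K
              (Rabs tau * Rabs d + Rabs (F zeta) + L * Rabs d) (fun _ => d))
    as [v [Cv Ev]].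
  - lra.
  - generalize (Rabs_pos tau) (Rabs_pos d) (Rabs_pos (F zeta)); intros.
    assert (0 <= Rabs tau * Rabs d) by (apply Rmult_le_pos; assumption).
    assert (0 <= L * Rabs d) by (apply Rmult_le_pos; assumption). lra.
  - intros u Hu t. apply (ex_derive_continuous (K := R_AbsRing) (V := R_NormedModule)).
    exists (acc u t). apply DN, Hu.
  - intros u w M HM Hu Hw Huw t Ht.
    assert (Hpos : forall s, 0 <= s -> Rabs (pos u s - pos w s) <= M * exp (K * s)).
    { intros s Hs. unfold pos.
      replace (zeta + RInt u 0 s - (zeta + RInt w 0 s)) with (RInt (fun r => minus (u r) (w r)) 0 s).
      - eapply Rle_trans.
        + apply RInt_exp_weight_le with (M := M) (K := K); [lra|exact Hs| |].
          * intros r. apply (continuous_minus u w); auto.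
          * intros r Hr. apply Huw, Hr.
        + apply Rmult_le_compat_r; [left; apply exp_pos|].
          apply Rmult_le_reg_r with K; [lra|]. unfold Rdiv.
          rewrite Rmult_assoc, Rinv_l by lra. nra.
      - rewrite (RInt_minus (V := R_CompleteNormedModule)) by (apply (ex_RInt_continuous (V := R_CompleteNormedModule)); auto).
        unfold minus, plus, opp; simpl. ring. }
    unfold N.
    replace (d + RInt (acc u) 0 t - (d + RInt (acc w) 0 t))
      with (RInt (fun r => minus (acc u r) (acc w r)) 0 t).
    + eapply Rle_trans.
      * apply RInt_exp_weight_le with (M := (Rabs tau + L) * M) (K := K); [lra|exact Ht| |].
        -- intros r. apply (continuous_minus (acc u) (acc w)); auto.
        -- intros r Hr. change (minus (acc u r) (acc w r)) with (acc u r - acc w r).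
           unfold acc.
           replace (- tau * u r - F (pos u r) - (- tau * w r - F (pos w r)))
             with (- (tau * (u r - w r) + (F (pos u r) - F (pos w r)))) by ring.
           rewrite Rabs_Ropp.
           eapply Rle_trans; [apply Rabs_triang|]. rewrite Rabs_mult.
           generalize (Huw r Hr) (Hpos r Hr) (HF (pos u r) (pos w r)) (Rabs_pos tau); intros.
           nra.
      * apply Rmult_le_compat_r; [left; apply exp_pos|].
        apply Rmult_le_reg_r with K; [lra|]. unfold Rdiv.
        rewrite (Rmult_assoc _ (/ K)), Rinv_l by lra. unfold K. nra.
    + rewrite (RInt_minus (V := R_CompleteNormedModule)) by (apply (ex_RInt_continuous (V := R_CompleteNormedModule)); auto).
      unfold minus, plus, opp; simpl. ring.
  - intros t. apply continuous_const.
  - intros t Ht. unfold N.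
    rewrite Rplus_minus_l.
    set (B := Rabs tau * Rabs d + Rabs (F zeta) + L * Rabs d).
    eapply Rle_trans.
    + apply RInt_exp_weight_le with (M := B) (K := K); [lra|exact Ht| |].
      * apply Cacc. intros s. apply continuous_const.
      * intros s Hs. unfold acc, pos.
        rewrite RInt_const. change (scal (s - 0) d) with ((s - 0) * d).
        generalize (HF (zeta + (s - 0) * d) zeta).
        replace (zeta + (s - 0) * d - zeta) with (s * d) by ring.
        rewrite Rabs_mult, (Rabs_pos_eq s Hs). intros H1.
        set (z := F (zeta + (s - 0) * d)) in *.
        replace (- tau * d - z) with (- (tau * d + (F zeta + (z - F zeta)))) by ring.
        rewrite Rabs_Ropp.
        generalize (Rabs_triang (tau * d) (F zeta + (z - F zeta)))
          (Rabs_triang (F zeta) (z - F zeta)).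
        rewrite (Rabs_mult tau d). intros.
        destruct (Hexp s Hs) as [He1 He2].
        generalize (Rabs_pos tau) (Rabs_pos d) (Rabs_pos (F zeta)); intros.
        assert (0 <= Rabs tau * Rabs d) by (apply Rmult_le_pos; assumption).
        assert (0 <= L * Rabs d) by (apply Rmult_le_pos; assumption).
        unfold B. nra.
    + apply Rmult_le_compat_r; [left; apply exp_pos|].
      assert (0 <= B).
      { unfold B. generalize (Rabs_pos tau) (Rabs_pos d) (Rabs_pos (F zeta)); intros.
        assert (0 <= Rabs tau * Rabs d) by (apply Rmult_le_pos; assumption).
        assert (0 <= L * Rabs d) by (apply Rmult_le_pos; assumption). lra. }
      apply Rmult_le_reg_r with K; [lra|]. unfold Rdiv.
      rewrite Rmult_assoc, Rinv_l by lra. nra.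
  (* [v] and [N v] are known to agree only from time 0 on. Taking [N v] as the velocity gives a
     two-sided derivative even at 0. *)
  - exists (pos v), (N v). split; [|split; [|intros t Ht; split]].
    + unfold pos. rewrite RInt_point. apply Rplus_0_r.
    + unfold N. rewrite RInt_point. apply Rplus_0_r.
    + rewrite <- (Ev t Ht). exact (Dpos v Cv t).
    + rewrite <- (Ev t Ht). exact (DN v Cv t).
Qed.

(** * The truncated problem and confinement by energy *)

Definition clamp (x : R) : R := Rmax (-1) (Rmin x 2).

Lemma clamp_id (x : R) : -1 <= x <= 2 -> clamp x = x.
Proof.
  intros Hx. unfold clamp. rewrite Rmin_left, Rmax_right; lra.
Qed.

Definition clamped_force (x : R) : R := clamp x ^ 2 - 1.

Lemma clamped_force_lipschitz (x y : R) :
  Rabs (clamped_force x - clamped_force y) <= 4 * Rabs (x - y).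
Proof.
  unfold clamped_force.
  replace (clamp x ^ 2 - 1 - (clamp y ^ 2 - 1))
    with ((clamp x + clamp y) * (clamp x - clamp y)) by ring.
  rewrite Rabs_mult.
  apply Rmult_le_compat; try apply Rabs_pos; unfold clamp, Rmax, Rmin, Rabs;
    repeat destruct Rle_dec; repeat destruct Rcase_abs; lra.
Qed.

Lemma clamped_force_continuous (x : R) : continuous clamped_force x.
Proof.
  apply (lipschitz_continuous _ 4), clamped_force_lipschitz.
Qed.

(* The constant makes this equal to [x ^ 3 / 3 - x] on [-1, 2]. *)
Definition clamped_potential (x : R) : R := 2 / 3 + RInt clamped_force (-1) x.

Lemma is_derive_clamped_potential (x : R) :
  is_derive clamped_potential x (clamped_force x).
Proof.
  unfold clamped_potential. rewrite <- (Rplus_0_l (clamped_force x)).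
  apply (is_derive_plus (fun _ => 2 / 3) (fun x => RInt clamped_force (-1) x));
    [apply (is_derive_const (2 / 3))|].
  apply (is_derive_RInt clamped_force (fun s => RInt clamped_force (-1) s) (-1));
    [|apply clamped_force_continuous].
  apply filter_forall. intros s. apply (RInt_correct (V := R_CompleteNormedModule)).
  apply (ex_RInt_continuous (V := R_CompleteNormedModule)).
  intros; apply clamped_force_continuous.
Qed.

Lemma clamped_potential_mid (x : R) :
  -1 <= x <= 2 -> clamped_potential x = x ^ 3 / 3 - x.
Proof.
  intros Hx. unfold clamped_potential.
  rewrite (is_RInt_unique clamped_force (-1) x (minus (x ^ 3 / 3 - x) ((-1) ^ 3 / 3 - -1))).
  - unfold minus, plus, opp; simpl. field.
  - apply (is_RInt_ext (fun s => s ^ 2 - 1)).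
    + rewrite Rmin_left, Rmax_right by lra. intros s Hs.
      unfold clamped_force. rewrite clamp_id by lra. reflexivity.
    + apply (is_RInt_derive (fun s => s ^ 3 / 3 - s)).
      * intros s _. auto_derive; [trivial|]. field.
      * intros s _. apply (ex_derive_continuous (K := R_AbsRing) (V := R_NormedModule)).
        auto_derive; trivial.
Qed.

(* The clamped force vanishes left of -1 and is 3 right of 2, so the clamped
   potential is at least 2/3 outside (-1, 2): the energy bound alone confines
   the trajectory. *)
Lemma clamped_potential_trap (x : R) : clamped_potential x < 2 / 3 -> -1 < x < 2.
Proof.
  intros Hx.
  assert (Hmono : forall y z, y <= z ->
    exists c, y <= c <= z /\
      clamped_potential z - clamped_potential y = clamped_force c * (z - y)).
  { intros y z Hyz.
    destruct (MVT_gen clamped_potential y z clamped_force) as [c [Hc E]].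
    - intros; apply is_derive_clamped_potential.
    - intros s _. apply continuity_pt_filterlim.
      apply (ex_derive_continuous (K := R_AbsRing) (V := R_NormedModule)).
      eexists; apply is_derive_clamped_potential.
    - rewrite Rmin_left, Rmax_right in Hc by lra. exists c. split; assumption. }
  split.
  - apply Rnot_le_lt. intros Hle.
    destruct (Hmono x (-1) Hle) as [c [Hc E]].
    rewrite (clamped_potential_mid (-1)) in E by lra.
    assert (clamped_force c = 0).
    { unfold clamped_force, clamp. rewrite Rmin_left, Rmax_left by lra. ring. }
    rewrite H in E. lra.
  - apply Rnot_le_lt. intros Hle.
    destruct (Hmono 2 x Hle) as [c [Hc E]].
    rewrite (clamped_potential_mid 2) in E by lra.
    assert (clamped_force c = 3).
    { unfold clamped_force, clamp. rewrite Rmin_right, Rmax_right by lra. ring. }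
    rewrite H in E. lra.
Qed.

(** The quantity conserved by the equation without damping; [calP] bounds it by 2/3 at the initial
    data. *)
Definition energy (x v : R) : R := v ^ 2 / 2 + (x ^ 3 / 3 - x).

Lemma trapped_global_solution (tau zeta d : R) :
  0 < tau -> calP (zeta, d) ->
  exists x v : R -> R, x 0 = zeta /\ v 0 = d /\
    forall t, 0 <= t ->
      is_derive x t (v t) /\ is_derive v t (- tau * v t - (x t ^ 2 - 1)) /\
      -1 < x t < 2 /\ energy (x t) (v t) <= energy zeta d.
Proof.
  intros Htau [Hz He].
  destruct (lipschitz_second_order_ivp tau zeta d 4 clamped_force clamped_force_lipschitz)
    as (x & v & X0 & V0 & D).
  exists x, v. split; [exact X0|split; [exact V0|]].
  (* By [x ^ 3 / 3 - x - 2 / 3 = (x + 1) ^ 2 * (x - 2) / 3], a start at or beyond 2 would have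
     energy at least 2/3. So [zeta] lies where the clamped potential is the cubic. *)
  assert (Hz2 : zeta < 2).
  { apply Rnot_le_lt. intros H2.
    generalize (pow2_ge_0 d) (pow2_ge_0 (zeta + 1)); intros.
    assert (0 <= (zeta + 1) ^ 2 * (zeta - 2)) by (apply Rmult_le_pos; lra).
    lra. }
  set (E := fun t => v t ^ 2 / 2 + clamped_potential (x t)).
  assert (DE : forall t, 0 <= t -> is_derive E t (- tau * v t ^ 2)).
  { intros t Ht. destruct (D t Ht) as [Dx Dv].
    unfold E.
    assert (Dp : is_derive (fun t => clamped_potential (x t)) t (v t * clamped_force (x t))).
    { apply (is_derive_comp clamped_potential x); [apply is_derive_clamped_potential|exact Dx]. }
    replace (- tau * v t ^ 2) with
      ((- tau * v t - clamped_force (x t)) * v t + v t * clamped_force (x t)) by ring.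
    apply (is_derive_plus (fun t => v t ^ 2 / 2) (fun t => clamped_potential (x t))); [|exact Dp].
    auto_derive; [eexists; exact Dv|].
    replace (Derive (fun x => v x) t) with (- tau * v t - clamped_force (x t))
      by (symmetry; apply is_derive_unique; exact Dv).
    field. }
  assert (HE : forall t, 0 <= t -> E t <= E 0).
  { intros t Ht.
    replace (E 0) with (E 0 * exp (0 * t)) by (rewrite Rmult_0_l, exp_0; ring).
    apply (gronwall E (fun t => - tau * v t ^ 2)); [exact Ht| | |].
    - intros s Hs. apply DE. lra.
    - intros s Hs. apply continuity_pt_filterlim.
      apply (ex_derive_continuous (K := R_AbsRing) (V := R_NormedModule)).
      eexists; apply DE; lra.
    - intros s Hs. generalize (pow2_ge_0 (v s)); nra. }
  assert (E0 : E 0 = energy zeta d).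
  { unfold E, energy. rewrite X0, V0, clamped_potential_mid by lra. reflexivity. }
  intros t Ht.
  assert (Hx : -1 < x t < 2).
  { apply clamped_potential_trap.
    generalize (HE t Ht) (pow2_ge_0 (v t)). rewrite E0. unfold E, energy. lra. }
  destruct (D t Ht) as [Dx Dv].
  split; [exact Dx|split; [|split; [exact Hx|]]].
  - unfold clamped_force in Dv. rewrite clamp_id in Dv by lra. exact Dv.
  - generalize (HE t Ht). rewrite E0. unfold E, energy at 1.
    rewrite clamped_potential_mid by lra. trivial.
Qed.

(** * Exponential convergence to the equilibrium 1 *)

(* With [y = x - 1] and [H = energy + 2/3], the functional [H + eps * y * v] is a strict
   Lyapunov function for small [eps], because the energy bound keeps
   [x + 1] away from 0. *)
Lemma trapped_solution_limit (tau e0 : R) (x v : R -> R) :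
  0 < tau -> e0 < 2 / 3 ->
  (forall t, 0 <= t ->
      is_derive x t (v t) /\ is_derive v t (- tau * v t - (x t ^ 2 - 1)) /\
      -1 < x t < 2 /\ energy (x t) (v t) <= e0) ->
  is_lim x p_infty 1.
Proof.
  intros Htau He0 D.
  set (delta := Rmin 1 (2 / 3 - e0)).
  assert (Hdelta : 0 < delta <= 1).
  { unfold delta. split; [apply Rmin_glb_lt; lra|apply Rmin_l]. }
  (* The energy bound reads [3 * delta <= (x + 1) ^ 2 * (2 - x)], whence [delta <= (x + 1) ^ 2]; the
     cap [delta <= 1] removes the square. *)
  assert (Hx1 : forall t, 0 <= t -> delta <= x t + 1).
  { intros t Ht. destruct (D t Ht) as (_ & _ & Hx & HE).
    unfold energy in HE.
    assert (Hd' : delta <= 2 / 3 - e0) by apply Rmin_r.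
    generalize (pow2_ge_0 (v t)); intros.
    apply Rnot_lt_le. intros Hlt.
    assert (3 * delta <= (x t + 1) ^ 2 * (2 - x t)) by lra.
    assert ((x t + 1) ^ 2 * (2 - x t) <= (x t + 1) ^ 2 * 3).
    { apply Rmult_le_compat_l; [apply pow2_ge_0|lra]. }
    nra. }
  (* The bound 1/3 keeps the cross term within [H / 2]; the other one makes the cross term cost at
     most half of the damping [tau * v ^ 2]. *)
  set (eps := Rmin (/ 3) (tau / (2 * (1 + tau ^ 2 / (2 * delta))))).
  assert (Hden : 0 < 1 + tau ^ 2 / (2 * delta)).
  { assert (0 <= tau ^ 2 / (2 * delta)); [|lra].
    apply Rdiv_le_0_compat; [apply pow2_ge_0|lra]. }
  assert (Heps : 0 < eps <= / 3).
  { unfold eps. split; [|apply Rmin_l].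
    apply Rmin_glb_lt; [lra|]. apply Rdiv_lt_0_compat; lra. }
  assert (Heps2 : eps * (1 + tau ^ 2 / (2 * delta)) <= tau / 2).
  { assert (H : eps <= tau / (2 * (1 + tau ^ 2 / (2 * delta)))) by apply Rmin_r.
    apply Rmult_le_compat_r with (r := 1 + tau ^ 2 / (2 * delta)) in H; [|lra].
    eapply Rle_trans; [exact H|]. right. field. split; nra. }
  (* Chosen so that [c] times the upper bound [3 / 4 * v ^ 2 + 2 * y ^ 2] of [L] stays below the
     dissipation [tau / 2 * v ^ 2 + eps * delta / 2 * y ^ 2]. *)
  set (c := Rmin (2 * tau / 3) (eps * delta / 4)).
  assert (Hc : 0 < c).
  { unfold c. apply Rmin_glb_lt; [lra|].
    apply Rdiv_lt_0_compat; [apply Rmult_lt_0_compat; lra|lra]. }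
  assert (Hc1 : c <= 2 * tau / 3) by apply Rmin_l.
  assert (Hc2 : c <= eps * delta / 4) by apply Rmin_r.
  (* The factored potential shows that [H] dominates [v ^ 2 / 2 + (x - 1) ^ 2 / 3] as long as
     [x > -1]. *)
  set (H := fun t => v t ^ 2 / 2 + (x t - 1) ^ 2 * (x t + 2) / 3).
  set (L := fun t => H t + eps * (x t - 1) * v t).
  assert (Hcross : forall t, 0 <= t -> - (H t / 2) <= eps * (x t - 1) * v t <= H t / 2).
  { intros t Ht. destruct (D t Ht) as (_ & _ & Hx & _). unfold H.
    set (y := x t - 1). set (w := v t).
    generalize (pow2_ge_0 (w / 2 + eps * y)) (pow2_ge_0 (w / 2 - eps * y)); intros.
    assert (y ^ 2 * 1 <= y ^ 2 * (x t + 2)).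
    { apply Rmult_le_compat_l; [apply pow2_ge_0|lra]. }
    assert (eps ^ 2 * y ^ 2 <= / 9 * y ^ 2).
    { apply Rmult_le_compat_r; [apply pow2_ge_0|nra]. }
    generalize (pow2_ge_0 y); intros.
    split; nra. }
  set (L' := fun t => v t * (- tau * v t - (x t ^ 2 - 1)) + (x t ^ 2 - 1) * v t
                      + eps * (v t * v t + (x t - 1) * (- tau * v t - (x t ^ 2 - 1)))).
  assert (DL : forall t, 0 <= t -> is_derive L t (L' t)).
  { intros t Ht. destruct (D t Ht) as (Dx & Dv & _).
    unfold L, H. auto_derive; [repeat split; eexists; eassumption|].
    replace (Derive (fun s => v s) t) with (- tau * v t - (x t ^ 2 - 1))
      by (symmetry; apply is_derive_unique; exact Dv).
    replace (Derive (fun s => x s) t) with (v t)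
      by (symmetry; apply is_derive_unique; exact Dx).
    unfold L'. field. }
  assert (HL : forall t, 0 <= t -> L t <= L 0 * exp (- c * t)).
  { intros t Ht. apply (gronwall L L'); [exact Ht| | |].
    - intros s Hs. apply DL. lra.
    - intros s Hs. apply continuity_pt_filterlim.
      apply (ex_derive_continuous (K := R_AbsRing) (V := R_NormedModule)).
      eexists; apply DL; lra.
    - intros s [Hs _].
      generalize (Hcross s Hs) (Hx1 s Hs). destruct (D s Hs) as (_ & _ & Hx & _).
      unfold L, L', H. set (w := v s).
      replace (x s ^ 2 - 1) with ((x s - 1) * (x s + 1)) by ring.
      replace (x s + 2) with ((x s + 1) + 1) by ring.
      assert (Hz3 : x s + 1 <= 3) by lra. revert Hz3.
      set (y := x s - 1). set (z := x s + 1). intros Hz3 Hcr Hz.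
      assert (Hy : 0 <= y ^ 2) by apply pow2_ge_0.
      assert (Hw : 0 <= w ^ 2) by apply pow2_ge_0.
      assert (HyM : y ^ 2 * (z + 1) <= y ^ 2 * 4) by (apply Rmult_le_compat_l; lra).
      assert (HyD : y ^ 2 * delta <= y ^ 2 * z) by (apply Rmult_le_compat_l; lra).
      assert (Hdiss : - tau * w ^ 2 + eps * w ^ 2 - eps * tau * y * w - eps * (y ^ 2 * z)
                      <= - (tau / 2) * w ^ 2 - eps * delta / 2 * y ^ 2).
      { assert (Ham : - (tau * y * w) <= delta / 2 * y ^ 2 + tau ^ 2 / (2 * delta) * w ^ 2).
        { assert (0 <= / (2 * delta) * (delta * y + tau * w) ^ 2).
          { apply Rmult_le_pos; [left; apply Rinv_0_lt_compat; lra|apply pow2_ge_0]. }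
          replace (/ (2 * delta) * (delta * y + tau * w) ^ 2) with
            (delta / 2 * y ^ 2 + tau ^ 2 / (2 * delta) * w ^ 2 + tau * y * w) in H0
            by (field; lra).
          lra. }
        apply Rmult_le_compat_l with (r := eps) in Ham; [|lra].
        apply Rmult_le_compat_l with (r := eps) in HyD; [|lra].
        apply Rmult_le_compat_r with (r := w ^ 2) in Heps2; [|exact Hw].
        lra. }
      assert (Hup : c * (w ^ 2 / 2 + y ^ 2 * (z + 1) / 3 + eps * y * w)
                    <= c * (3 / 4 * w ^ 2 + 2 * y ^ 2)).
      { apply Rmult_le_compat_l; lra. }
      assert (c * w ^ 2 <= 2 * tau / 3 * w ^ 2) by (apply Rmult_le_compat_r; lra).
      assert (c * y ^ 2 <= eps * delta / 4 * y ^ 2) by (apply Rmult_le_compat_r; lra).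
      lra. }
  (* The 6 comes from [L >= H / 2] and [H >= (x - 1) ^ 2 / 3]. *)
  assert (Hy2 : forall t, 0 <= t -> (x t - 1) ^ 2 <= 6 * L 0 * exp (- c * t)).
  { intros t Ht. generalize (HL t Ht) (Hcross t Ht).
    destruct (D t Ht) as (_ & _ & Hx & _). unfold L at 1, H.
    assert ((x t - 1) ^ 2 * 1 <= (x t - 1) ^ 2 * (x t + 2)).
    { apply Rmult_le_compat_l; [apply pow2_ge_0|lra]. }
    generalize (pow2_ge_0 (v t)). lra. }
  assert (Hlim : is_lim (fun t => 6 * L 0 * exp (- c * t)) p_infty 0).
  { replace (Finite 0) with (Rbar_mult (6 * L 0) 0) by (simpl; f_equal; ring).
    apply is_lim_scal_l.
    apply (is_lim_comp exp (fun t => - c * t) p_infty 0 m_infty).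
    - apply is_lim_exp_m.
    - replace m_infty with (Rbar_mult (- c) p_infty).
      + apply is_lim_scal_l, is_lim_id.
      + simpl. destruct Rle_dec; [exfalso; lra|reflexivity].
    - exists 0. intros; discriminate. }
  apply is_lim_spec. intros e.
  apply is_lim_spec in Hlim.
  assert (Hee : 0 < e ^ 2) by (apply pow_lt, e).
  destruct (Hlim (mkposreal _ Hee)) as [M HM].
  exists (Rmax 0 M). intros t Ht.
  assert (Ht0 : 0 <= t) by (generalize (Rmax_l 0 M); lra).
  assert (HtM : M < t) by (generalize (Rmax_r 0 M); lra).
  generalize (HM t HtM) (Hy2 t Ht0). simpl pos. rewrite Rminus_0_r. intros H1 H2.
  generalize (Rle_abs (6 * L 0 * exp (- c * t))); intros H3.
  rewrite <- (Rabs_pos_eq e) by (left; apply e).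
  apply Rsqr_lt_abs_0. unfold Rsqr; lra.
Qed.

(** * Well-posedness and maximal solutions *)

Theorem proposition3p2 (tau : R) (htau : 0 < tau) (zeta d : R)
    (hP : calP (zeta, d)) :
  well_posed tau zeta d /\
  forall (T : Rbar) (theta : R -> R),
    is_maximal_solution tau zeta d T theta ->
    T = p_infty /\ is_lim theta p_infty 1.
Proof.
  destruct (trapped_global_solution tau zeta d htau hP) as (x & v & X0 & V0 & D).
  assert (Hsol : forall t, 0 <= t ->
     is_forward_derive x t (v t) /\
     is_forward_derive v t (- tau * v t - (x t ^ 2 - 1)) /\
     - tau * v t - (x t ^ 2 - 1) + tau * v t + x t ^ 2 - 1 = 0).
  { intros t Ht. destruct (D t Ht) as (Dx & Dv & _).
    split; [apply is_forward_derive_of_is_derive; assumption|].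
    split; [apply is_forward_derive_of_is_derive; assumption|ring]. }
  assert (Hx : is_solution tau zeta d p_infty x).
  { split; [exact I|].
    exists v, (fun t => - tau * v t - (x t ^ 2 - 1)).
    split; [intros t Ht _; apply Hsol, Ht|split; assumption]. }
  (* For each [t < S] both functions solve the equation on the compact interval from 0 to [t], where
     uniqueness applies. *)
  assert (Huniq : forall S u, is_solution tau zeta d S u -> agree_upto S u x).
  { intros S u [_ (u' & u'' & Hu & U0 & U0')] t Ht HtS.
    apply (ivp_unique tau t u u' u'' x v (fun t => - tau * v t - (x t ^ 2 - 1))).
    - exact Ht.
    - intros s [Hs Hst]. apply Hu; [exact Hs|].
      apply (Rbar_le_lt_trans s t S); [exact Hst|exact HtS].
    - intros s [Hs _]. apply Hsol, Hs.
    - congruence.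
    - congruence. }
  assert (Htop : forall S, Rbar_le S p_infty) by (intros []; exact I).
  split.
  - exists p_infty, x. split; [split; [exact Hx|]|].
    + intros S u _ _. apply Htop.
    + intros S u Hu. split; [apply Htop|apply Huniq, Hu].
  - intros T theta [Htheta Hmax].
    generalize (Huniq T theta Htheta); intros Hagree.
    assert (HT : T = p_infty).
    { assert (Hle : Rbar_le p_infty T).
      { apply (Hmax p_infty x Hx). intros t Ht HtT. symmetry. exact (Hagree t Ht HtT). }
      destruct T; [contradiction|reflexivity|contradiction]. }
    split; [exact HT|]. subst T.
    apply (is_lim_ext_loc x).
    + exists 0. intros t Ht. symmetry. apply Hagree; [left; exact Ht|exact I].
    + apply (trapped_solution_limit tau (energy zeta d) x v htau); [|exact D].
      destruct hP as [_ He]. unfold energy. lra.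
Qed.
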